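(* Let $v\in\{1,2\}^*$ and let $\lambda=\lambda(\phi(v))$ be the integer partition associated with the word $\phi(v)$, where $\phi$ is Foata's fundamental bijection. Then (i) $\operatorname{maj} v=|\lambda|$, and (ii) $\operatorname{des} v=d(\lambda)$.
   Context: $\{1,2\}^*$ is the set of all finite words in the letters $1,2$ (including the empty word $\epsilon$), and $\mathbb P^*$ is the set of all finite words in the positive integers. For $w=a_1\ldots a_n\in\mathbb P^*$: $\operatorname{Des} w=\{i: 1\le i<n,\ a_i>a_{i+1}\}$, $\operatorname{des} w=|\operatorname{Des} w|$, $\operatorname{maj} w=\sum_{i\in\operatorname{Des} w} i$. Foata's fundamental bijection $\phi:\mathbb P^*\to\mathbb P^*$: $\phi(\epsilon)=\epsilon$. For $v=a_1\ldots a_n$ with $n\ge1$, define $w_1=a_1$ and, given $w_i=b_1\ldots b_i$, define $w_{i+1}$ as follows. If $b_i\le a_{i+1}$ (respectively $b_i>a_{i+1}$), factor $w_i=f_1f_2\cdots f_k$ uniquely so that in each factor every letter is $>a_{i+1}$ (respectively $\le a_{i+1}$) except its last letter, which is $\le a_{i+1}$ (respectively $>a_{i+1}$). Let $g_j$ be obtained from $f_j$ by moving its last letter to the front, and set $w_{i+1}=g_1g_2\cdots g_k\,a_{i+1}$. Then $\phi(v)=w_n$. The map $\phi$ is a bijection preserving the multiset of letters. Partition of a word: for $w\in\{1,2\}^*$ with $m$ ones and $n$ twos, view $w$ as a lattice path from $(0,0)$ to $(n,m)$, a $1$ being a unit north step and a $2$ a unit east step. $\lambda(w)$ is the integer partition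 whose Ferrers diagram consists of the boxes of the $m\times n$ rectangle ($m$ rows, $n$ columns) lying northwest of this path. Equivalently, $\lambda_i$ is the number of twos preceding the $i$th one of $w$ counted from the right, $1\le i\le m$ (zero parts are discarded). $|\lambda|$ is the sum of the parts of $\lambda$, and $d(\lambda)$ is the side length of the Durfee square of $\lambda$: the largest $d\ge 0$ such that the $d\times d$ square is contained in the Ferrers diagram of $\lambda$ (i.e. $\lambda$ has at least $d$ parts of size at least $d$). *)

(* Defs.v *)
From mathcomp Require Import all_boot.

Set Implicit Arguments.
Unset Strict Implicit.
Unset Printing Implicit Defensive.

(* A word in the positive integers is a [seq nat] [:: a_1; ...; a_n]; the
   definitions below only compare letters, so the junk letter 0 is harmless. *)
Definition word12 (w : seq nat) : bool := all (mem [:: 1; 2]) w.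

(* Positions are 1-based as in the usual definition of maj, whereas [nth] is
   0-based: a_i = nth 0 w i.-1 and a_(i+1) = nth 0 w i. *)
Definition Des (w : seq nat) : seq nat :=
  [seq i <- iota 1 (size w).-1 | nth 0 w i.-1 > nth 0 w i].

Definition des (w : seq nat) : nat := size (Des w).

Definition maj (w : seq nat) : nat := \sum_(i <- Des w) i.

(* Cuts w after each letter satisfying P.  If the last letter of w satisfies P,
   as is the case in [foata_step], this is the unique factorization of w into
   nonempty words in which the last letter, and only it, satisfies P
   (see [factorsP]). *)
Fixpoint factors (P : pred nat) (w : seq nat) : seq (seq nat) :=
  if w is x :: w' then
    if P x then [:: x] :: factors P w'
    else if factors P w' is f :: fs then (x :: f) :: fs else [:: [:: x]]
  else [::].

(* From w = w_i (nonempty) and a = a_(i+1) to w_(i+1). *)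
Definition foata_step (w : seq nat) (a : nat) : seq nat :=
  let P := if last 0 w <= a then fun b => b <= a else fun b => b > a in
  rcons (flatten [seq rotr 1 f | f <- factors P w]) a.

Definition foata (v : seq nat) : seq nat :=
  if v is a :: v' then foldl foata_step [:: a] v' else [::].

(* The i-th entry is the number of twos preceding the i-th one of w counted
   from the right. *)
Definition rows (w : seq nat) : seq nat :=
  [seq count_mem 2 (take p w) | p <- rev (iota 0 (size w)) & nth 0 w p == 1].

(* A partition is the weakly decreasing sequence of its positive parts. *)
Definition is_partition (la : seq nat) : bool := sorted geq la && (0 \notin la).

Definition lambda (w : seq nat) : seq nat := [seq r <- rows w | 0 < r].

(* Box in row i (from the top) and column j (from the left), both 0-based. *)
Definition in_ferrers (la : seq nat) (i j : nat) : bool := j < nth 0 la i.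

Definition square_in_ferrers (la : seq nat) (d : nat) : bool :=
  [forall i : 'I_d, forall j : 'I_d, in_ferrers la i j].

(* d <= size la is no restriction: see [square_in_ferrers_size]. *)
Definition durfee (la : seq nat) : nat :=
  \max_(d < (size la).+1 | square_in_ferrers la d) d.

Lemma factorsP (P : pred nat) (w : seq nat) (fs : seq (seq nat)) :
  (w == [::]) || P (last 0 w) ->
  fs = factors P w <->
  flatten fs = w /\
  all (fun f => if f is x :: s then P (last x s) && ~~ has P (belast x s)
                else false) fs.
Proof.
move=> Pw; split=> [->|].
  split.
    elim: w {Pw} => [//|x w IH] /=; case: (P x) => /=; first by rewrite IH.
    by case: (factors P w) IH => [|f gs] /= <-.
  elim: w Pw => [//|x w IH] /= Pw.
  case: (boolP (P x)) => Px /=.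
    by rewrite Px IH //; case: w Pw {IH}.
  case: w IH Pw => [_|y w IH Pw]; first by rewrite /= (negbTE Px).
  have nz : factors P (y :: w) != [::].
    by rewrite /=; case: (P y) => //; case: (factors P w).
  move: (IH Pw) nz; case: (factors P (y :: w)) => [|[|z f] gs] //= + _.
  by rewrite negb_or Px.
case=> <- {w Pw}; elim: fs => [//|[//|x f] fs IH] /= /andP[/andP[Pl nP] /IH{}IH].
elim: f x Pl nP => [|y f IHf] x /= Pl; first by rewrite Pl -IH.
by rewrite negb_or => /andP[/negbTE-> nP]; rewrite -(IHf y Pl nP).
Qed.

Lemma rows_rcons (w : seq nat) (a : nat) :
  rows (rcons w a) = if a == 1 then count_mem 2 w :: rows w else rows w.
Proof.
rewrite /rows size_rcons -[(size w).+1]addn1 iotaD add0n rev_cat /= nth_rcons ltnn eqxx.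
have E : [seq count_mem 2 (take p (rcons w a)) |
           p <- rev (iota 0 (size w)) & nth 0 (rcons w a) p == 1] = rows w.
  rewrite (@eq_in_filter _ _ (fun p => nth 0 w p == 1)); last first.
    by move=> p; rewrite mem_rev mem_iota nth_rcons => /= ->.
  apply/eq_in_map => p; rewrite mem_filter mem_rev mem_iota add0n /= => /andP[_ lt].
  by rewrite -cats1 takel_cat // ltnW.
case: ifP => _ /=; rewrite E //.
by rewrite -cats1 take_size_cat.
Qed.

Lemma rows_sorted (w : seq nat) : sorted geq (rows w).
Proof.
have bnd u : all (geq (count_mem 2 u)) (rows u).
  apply/allP=> x /mapP[p _ ->] /=.
  by rewrite -{2}(cat_take_drop p u) count_cat leq_addr.
elim/last_ind: w => [//|w a IH]; rewrite rows_rcons; case: ifP => // _ /=.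
by rewrite (path_min_sorted (bnd w)).
Qed.

Lemma lambda_partition (w : seq nat) : is_partition (lambda w).
Proof.
apply/andP; split; last by rewrite mem_filter.
by apply: sorted_filter (rows_sorted w) => x y z /= h1 h2; apply: leq_trans h2 h1.
Qed.

Lemma nth_lambda (w : seq nat) (i : nat) : nth 0 (lambda w) i = nth 0 (rows w) i.
Proof.
rewrite /lambda; move: (rows_sorted w) i; elim: (rows w) => [//|x s IH] H i /=.
case: ltnP => [x0|]; first by case: i => [//|i] /=; rewrite IH // (path_sorted H).
rewrite leqn0 => /eqP x0.
have z : all (pred1 0) s.
  move: H; rewrite /= (path_sortedE (fun x y z h1 h2 => leq_trans h2 h1)) x0.
  by case/andP=> /allP H _; apply/allP => y /H /=; rewrite leqn0.
have -> : [seq r <- s | 0 < r] = [::].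
  by rewrite (@eq_in_filter _ _ pred0) ?filter_pred0 // => y /(allP z)/eqP->.
rewrite nth_nil x0; case: i => [//|i] /=.
case: (ltnP i (size s)) => h; last by rewrite nth_default.
by rewrite (eqP (all_nthP 0 z i h)).
Qed.

(* The word w as a lattice path from (0, 0): after p letters it has reached the
   point (count_mem 2 (take p w), count_mem 1 (take p w)).  With m ones in w, the
   box in row i from the top and column j has southeast corner (j + 1, m - i - 1);
   the box lies northwest of the path iff this corner is weakly northwest of some
   point of the path. *)
Lemma ferrers_lambda (w : seq nat) (i j : nat) :
  in_ferrers (lambda w) i j <->
  exists p, j < count_mem 2 (take p w) /\
            count_mem 1 (take p w) + i < count_mem 1 w.
Proof.
rewrite /in_ferrers nth_lambda.
elim/last_ind: w i => [|w a IH] i.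
  by rewrite nth_nil; split=> // [[p []]].
have tk p : take p (rcons w a) = if p <= size w then take p w else rcons w a.
  case: leqP => h; last by rewrite take_oversize // size_rcons.
  by rewrite -cats1 takel_cat.
have tk' p : exists2 q, q <= size w & take p w = take q w.
  case: (leqP p (size w)) => h; first by exists p.
  by exists (size w) => //; rewrite take_size take_oversize // ltnW.
have cnt c : count_mem c (rcons w a) = count_mem c w + (a == c).
  by rewrite -cats1 count_cat /= addn0.
have le p : count_mem 1 (take p w) <= count_mem 1 w.
  by rewrite -{2}(cat_take_drop p w) count_cat leq_addr.
have le2 p : count_mem 2 (take p w) <= count_mem 2 w.
  by rewrite -{2}(cat_take_drop p w) count_cat leq_addr.
rewrite rows_rcons (cnt 1); case: (altP (a =P 1)) => [a1|a1]; last first.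
  rewrite addn0; split=> [/IH|] [p []].
    have [q qw ->] := tk' p; move=> h1 h2; exists q; by rewrite tk qw.
  rewrite tk; case: (leqP p (size w)) => _; first by move=> h1 h2; apply/IH; exists p.
  by rewrite (cnt 1) (negbTE a1) => _; rewrite -addnA ltnNge leq_addr.
case: i => [|i] /=.
  split=> [h|[p]].
    by exists (size w); rewrite tk leqnn take_size addn0 addn1.
  rewrite tk; case: (leqP p (size w)) => _ [h]; first by move=> _; apply: leq_trans h (le2 p).
  by rewrite (cnt 1) a1 addn0 ltnn.
rewrite addn1; split=> [/IH|] [p []].
  by have [q qw ->] := tk' p; move=> h1 h2; exists q; rewrite tk qw addnS.
rewrite tk; case: (leqP p (size w)) => _; first by move=> h1; rewrite addnS => h2; apply/IH; exists p.
by rewrite (cnt 1) a1 addn1 addnS !ltnS => _; rewrite ltnNge addSn -addnS leq_addr.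
Qed.

Lemma square_in_ferrers_size (la : seq nat) (d : nat) :
  square_in_ferrers la d -> d <= size la.
Proof.
case: d => [//|d] /forallP/(_ ord_max)/forallP/(_ ord0); rewrite /in_ferrers /= => h.
by rewrite leqNgt; apply: contraL h => h; rewrite nth_default.
Qed.

(* Main.v *)
Require Import Defs.
From mathcomp Require Import all_boot.

(** On words in the letters 1 and 2 a step of Foata's bijection is very simple.
    Appending a 2 to w cuts w into single letters and leaves it unchanged.
    Appending a 1 cuts w after every copy of its last letter b, and rotating all
    the factors then amounts to moving the final b to the front
    ([flatten_rotr_factors]): w = ub becomes bu1.  Reading off partitions:
    - w to w2 does not change the rows, a final east step bounding no row;
    - u1 to 1u1 only appends an empty row, so the partition is the same;
    - u2 to 2u1 adds one box to each of the rows of u, and a new top row one box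
      longer than the number of twos of u.
    The last letter of v is also the last letter of its image, so exactly the
    last case creates a descent in v, at position |u| + 1.  There the
    diagram gains a hook: a new first column with one box per one of u, and a new
    first row with one box per two of u plus the corner box.  So the size grows by
    |u| + 1, which is the increase of maj, and since the new first row is at least
    as long as all others, the Durfee square grows by exactly one
    ([durfee_add_hook]), like des.  The theorem follows by induction on v, adding
    letters on the right. *)

(** * Descents and the steps of Foata's bijection *)

(** The default 0 of [last] is below every letter that could follow, or equal to
    it, so that the empty word correctly yields no descent. *)
Lemma Des_rcons v a :
  Des (rcons v a) = if a < last 0 v then rcons (Des v) (size v) else Des v.
Proof.
case: (lastP v) => [//|{}v b]; rewrite last_rcons /Des !size_rcons.
rewrite -[_.+2.-1]addn1 iotaD add1n filter_cat /=.
rewrite !nth_rcons !size_rcons ltnn eqxx ltnSn ltnn eqxx.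
rewrite (@eq_in_filter _ _ (fun i => nth 0 (rcons v b) i < nth 0 (rcons v b) i.-1)).
  by case: ifP => _; rewrite ?cats1 ?cats0.
move=> [|i]; rewrite mem_iota //= add1n ltnS => lt_iv.
by rewrite ![nth 0 (rcons (rcons v b) a) _]nth_rcons !size_rcons !ltnS lt_iv (ltnW lt_iv).
Qed.

Lemma des_rcons v a : des (rcons v a) = des v + (a < last 0 v).
Proof.
by rewrite /des Des_rcons; case: ifP => _; rewrite ?size_rcons ?addn1 ?addn0.
Qed.

Lemma maj_rcons v a : maj (rcons v a) = maj v + (a < last 0 v) * size v.
Proof.
rewrite /maj Des_rcons; case: ifP => _; last by rewrite addn0.
by rewrite big_rcons mul1n.
Qed.

Lemma foata_rcons v a : foata (rcons v a) = foata_step (foata v) a.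
Proof. by case: v => [|b v] //=; rewrite -cats1 foldl_cat. Qed.

Lemma last_foata v : last 0 (foata v) = last 0 v.
Proof.
by case: (lastP v) => [//|{}v a]; rewrite foata_rcons /foata_step !last_rcons.
Qed.

Lemma flatten_factors P w : flatten (factors P w) = w.
Proof.
elim: w => [//|x w IH] /=; case: (P x) => /=; first by rewrite IH.
by case: (factors P w) IH => [|f fs] /= <-.
Qed.

Lemma perm_foata_step w a : perm_eq (foata_step w a) (rcons w a).
Proof.
rewrite /foata_step -!cats1 perm_cat2r; set P := if _ then _ else _.
rewrite -[X in perm_eq _ X](flatten_factors P w).
by elim: (factors P w) => [//|f fs IH] /=; rewrite perm_cat // perm_rot.
Qed.

Lemma perm_foata v : perm_eq (foata v) v.
Proof.
elim/last_ind: v => [//|v a IH]; rewrite foata_rcons.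
by apply: perm_trans (perm_foata_step _ _) _; rewrite -!cats1 perm_cat2r.
Qed.

Lemma nil_notin_factors P w : [::] \notin factors P w.
Proof.
elim: w => [//|x w IH] /=; case: (P x) => //=.
by case: (factors P w) IH => [|f fs]; rewrite // !inE !negb_or => /andP[].
Qed.

(** Every factor returns its final c to its own front, that is, to where the
    previous factor had its c.  So the word reads as before, except that there is
    a new c in front and none left at the end. *)
Lemma flatten_rotr_factors (P : pred nat) c u :
    P c -> {in u, forall x, P x -> x = c} ->
  flatten [seq rotr 1 f | f <- factors P (rcons u c)] = c :: u.
Proof.
move=> Pc; elim: u => [|x u IH] Pu /=; first by rewrite Pc.
have {}IH := IH (fun y uy => Pu y (mem_behead (s := x :: u) uy)).
case: ifP => [/(Pu x (mem_head x u))-> /=|_]; first by rewrite IH.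
move: (nil_notin_factors P (rcons u c)) IH.
case: (factors P (rcons u c)) => [//|f fs] /=.
case: (lastP f) => [//|{}f y] _.
by rewrite -rcons_cons !rotr1_rcons /= => -[-> ->].
Qed.

Lemma word12_rcons w a : word12 (rcons w a) = (a \in [:: 1; 2]) && word12 w.
Proof. exact: all_rcons. Qed.

Lemma foata_step2 w : word12 w -> foata_step w 2 = rcons w 2.
Proof.
case: (lastP w) => [//|{}w b]; rewrite word12_rcons /foata_step last_rcons.
move=> /andP[b12 w12]; have -> : b <= 2 by move: b12; rewrite !inE => /orP[]/eqP->.
congr (rcons _ 2); rewrite -[RHS](flatten_factors (leq^~ 2)); congr flatten.
have: word12 (rcons w b) by rewrite word12_rcons b12.
elim: (rcons w b) => [//|x s IH] /= /andP[x12 /IH].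
have -> : x <= 2 by move: x12; rewrite !inE => /orP[]/eqP->.
by move=> /= ->.
Qed.

Lemma foata_step1 u b : word12 (rcons u b) -> foata_step (rcons u b) 1 = b :: rcons u 1.
Proof.
rewrite word12_rcons /foata_step last_rcons -rcons_cons => /andP[b12 /allP u12].
by move: b12; rewrite !inE => /orP[]/eqP->; congr (rcons _ 1);
  apply: flatten_rotr_factors => // x /u12; rewrite !inE => /orP[]/eqP->.
Qed.

(** * Rows of the diagram of a word *)

Lemma rows_cons1 u : rows (1 :: u) = rcons (rows u) 0.
Proof.
elim/last_ind: u => [//|u a IH].
by rewrite -rcons_cons !rows_rcons IH; case: ifP.
Qed.

Lemma rows_cons2 u : rows (2 :: u) = map S (rows u).
Proof.
elim/last_ind: u => [//|u a IH].
by rewrite -rcons_cons !rows_rcons IH; case: ifP.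
Qed.

Lemma size_rows w : size (rows w) = count_mem 1 w.
Proof.
elim/last_ind: w => [//|w a IH].
by rewrite rows_rcons -cats1 count_cat /= -IH; case: ifP; rewrite ?addn0 ?addn1.
Qed.

Lemma size_word12 w : word12 w -> size w = count_mem 1 w + count_mem 2 w.
Proof.
elim: w => [//|x w IH] /= /andP[x12 /IH->].
by move: x12; rewrite !inE => /orP[]/eqP->; rewrite ?addnS.
Qed.

Lemma sumn_lambda w : sumn (lambda w) = sumn (rows w).
Proof. by rewrite /lambda; elim: (rows w) => [//|[|r] s IH] //=; rewrite IH. Qed.

Lemma lambda_cons1 u : lambda (1 :: u) = lambda u.
Proof. by rewrite /lambda rows_cons1 filter_rcons. Qed.

(** * Durfee squares *)

Lemma square_in_ferrersP la d :
  reflect (forall i, i < d -> d <= nth 0 la i) (square_in_ferrers la d).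
Proof.
apply: (iffP forallP) => [sq i lt_id | le_d i].
  by case: d i lt_id sq => // d i lt_id /(_ (Ordinal lt_id))/forallP/(_ ord_max).
by apply/forallP => j; apply: leq_trans (ltn_ord j) (le_d i (ltn_ord i)).
Qed.

Lemma square_in_ferrers_leq la d e :
  d <= e -> square_in_ferrers la e -> square_in_ferrers la d.
Proof.
move=> le_de /square_in_ferrersP sq; apply/square_in_ferrersP => i lt_id.
by rewrite (leq_trans le_de) // sq // (leq_trans lt_id).
Qed.

(** Holds because squares sharing a corner are nested.  It characterizes the
    Durfee side by its lower bounds, so no maximum has to be computed below. *)
Lemma leq_durfee la d : (d <= durfee la) = square_in_ferrers la d.
Proof.
apply/idP/idP => [le_d | sq].
  apply: square_in_ferrers_leq le_d _; rewrite /durfee.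
  by elim/big_ind: _ => [|x y|//]; [apply/square_in_ferrersP | rewrite /maxn; case: ifP].
have lt_d : d < (size la).+1 by rewrite ltnS square_in_ferrers_size.
exact: (@leq_bigmax_cond _ _ val (Ordinal lt_d) sq).
Qed.

Lemma eq_durfee la mu : nth 0 la =1 nth 0 mu -> durfee la = durfee mu.
Proof.
move=> eq_nth; apply/eqP; rewrite eqn_leq !leq_durfee.
have sqE d : square_in_ferrers la d = square_in_ferrers mu d.
  by apply/square_in_ferrersP/square_in_ferrersP => sq i /sq; rewrite eq_nth.
by rewrite -sqE -leq_durfee leqnn sqE -leq_durfee leqnn.
Qed.

(** Adding a new first column and a new first row pushes every square one box
    down and to the right.  The new row is long enough to complete the pushed
    square of side d to one of side d + 1, because k bounds the old first row
    and hence d. *)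
Lemma durfee_add_hook k la :
  sorted geq (k :: la) -> durfee (k.+1 :: map S la) = (durfee la).+1.
Proof.
move=> srt.
have sqE d : square_in_ferrers (k.+1 :: map S la) d.+1 = square_in_ferrers la d.
  apply/square_in_ferrersP/square_in_ferrersP => [sq i lt_id | sq [_|i lt_id] /=].
  - have := sq i.+1 lt_id; rewrite /=.
    case: (ltnP i (size la)) => ?; first by rewrite (nth_map 0).
    by rewrite nth_default ?size_map.
  - case: d la srt sq => [//|d] [|r la] /= srt /(_ 0 isT) //= le_dr.
    by rewrite ltnS (leq_trans le_dr) //; case/andP: srt.
  - have le_d := sq i lt_id; rewrite (nth_map 0) ?ltnS //.
    rewrite ltnNge; apply: contraL le_d => le_la.
    by rewrite nth_default // -ltnNge; apply: (@leq_trans i.+1).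
apply/eqP; rewrite eqn_leq [X in _ && X]leq_durfee sqE -leq_durfee leqnn andbT.
case E: (durfee _) => [//|d].
by rewrite ltnS leq_durfee -sqE -leq_durfee E.
Qed.

(** * The effect of one step on the partition *)

Lemma lambda_foata_step_ascent w a :
    word12 w -> a \in [:: 1; 2] -> last 0 w <= a ->
  lambda (foata_step w a) = lambda w.
Proof.
move=> w12; rewrite !inE => /orP[]/eqP->; last first.
  by rewrite foata_step2 // /lambda rows_rcons.
case: (lastP w) w12 => [//|u b] ub12; rewrite last_rcons => le_b1.
have b1: b = 1.
  by move: ub12 le_b1; rewrite word12_rcons !inE => /andP[/orP[]/eqP->].
by rewrite foata_step1 // b1 lambda_cons1.
Qed.

Lemma rows_foata_step_descent u :
    word12 (rcons u 2) ->
  rows (foata_step (rcons u 2) 1) = (count_mem 2 u).+1 :: map S (rows u).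
Proof. by move=> u12; rewrite foata_step1 // -rcons_cons rows_rcons rows_cons2. Qed.

Lemma sumn_foata_step_descent u :
    word12 (rcons u 2) ->
  sumn (lambda (foata_step (rcons u 2) 1)) = sumn (lambda (rcons u 2)) + (size u).+1.
Proof.
move=> u12; rewrite !sumn_lambda rows_foata_step_descent // rows_rcons /=.
have /size_word12-> : word12 u by move: u12; rewrite word12_rcons => /andP[].
have -> : sumn (map S (rows u)) = count_mem 1 u + sumn (rows u).
  rewrite -size_rows; elim: (rows u) => [//|r s IH] /=.
  by rewrite IH addSn addnCA.
by rewrite addSn addnS addnA [sumn _ + _]addnC [count_mem 2 u + _]addnC.
Qed.

Lemma durfee_foata_step_descent u :
    word12 (rcons u 2) ->
  durfee (lambda (foata_step (rcons u 2) 1)) = (durfee (lambda (rcons u 2))).+1.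
Proof.
move=> u12; rewrite !(eq_durfee _ _ (nth_lambda _)).
rewrite rows_foata_step_descent // rows_rcons /= durfee_add_hook //.
by have := rows_sorted (rcons u 1); rewrite rows_rcons.
Qed.

Theorem corollary2p4 (v : seq nat) (hv : word12 v) :
  let la := lambda (foata v) in
  maj v = sumn la /\ des v = durfee la.
Proof.
elim/last_ind: v hv => [|v a IH] hv /=.
  split; first by rewrite /maj big_nil.
  apply/esym/eqP; rewrite -leqn0.
  by apply: (@square_in_ferrers_size [::]); rewrite -leq_durfee.
move: hv; rewrite word12_rcons => /andP[a12 v12].
have [majE desE] := IH v12.
have fv12 : word12 (foata v) by rewrite /word12 (perm_all _ (perm_foata v)).
rewrite maj_rcons des_rcons foata_rcons majE desE -last_foata.
rewrite -(perm_size (perm_foata v)).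
case: leqP => [le_a|]; first by rewrite lambda_foata_step_ascent // !addn0.
case: (lastP (foata v)) fv12 => [//|u b] ub12; rewrite last_rcons => lt_ab.
have [a1 b2] : a = 1 /\ b = 2.
  move: ub12 a12 lt_ab; rewrite word12_rcons !inE => /andP[/orP[]/eqP-> _].
    by case/orP=> /eqP->.
  by case/orP=> /eqP->.
move: ub12; rewrite a1 b2 => u12.
by rewrite sumn_foata_step_descent // durfee_foata_step_descent // size_rcons mul1n addn1.
Qed.
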